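(* Let $N\ge1$, let $z_1^{(1)}>\dots>z_{N-1}^{(1)}>0$ be the zeros of the Laguerre polynomial $L_{N-1}^{(1)}$ (orthogonal w.r.t. $e^{-x}x$ on $]0,\infty[$), and let $r=(r_1,\dots,r_N)\in C_N^D$ with $r_i:=\sqrt{2z_i^{(1)}}$ for $i\le N-1$ and $r_N:=0$. For $k>0$ let $(X_{t,k})_{t\ge0}$ be the Bessel process of type $D_N$ with multiplicity $k$ started in $0$. Define $S=(s_{i,j})_{i,j=1,\dots,N}$ by $$s_{i,i}:=1+2\sum_{l\ne i}(r_i-r_l)^{-2}+2\sum_{l\ne i}(r_i+r_l)^{-2},\qquad s_{i,j}:=2(r_i+r_j)^{-2}-2(r_i-r_j)^{-2}\ (i\ne j).$$ Then $S$ is invertible and, with $\Sigma:=S^{-1}$, for every $t>0$, $$X_{t,k}-\sqrt{kt}\,r\ \longrightarrow\ N(0,t\Sigma)\qquad\text{in distribution as }k\to\infty.$$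
   Context: $C_N^D:=\{x\in\mathbb R^N: x_1\ge\dots\ge x_{N-1}\ge|x_N|\}$. For $k\ge0$, the Bessel process of type $D_N$ with multiplicity $k$ is the diffusion on $C_N^D$ with reflecting boundary and generator $Lf=\frac12\Delta f+k\sum_{i=1}^N\sum_{j\ne i}\big(\frac{1}{x_i-x_j}+\frac{1}{x_i+x_j}\big)\frac{\partial f}{\partial x_i}$; started in $0$, $X_{t,k}$ has density on $C_N^D$ proportional to $e^{-\|y\|^2/(2t)}\prod_{i<j}(y_i^2-y_j^2)^{2k}$. $N(0,t\Sigma)$ is the centered normal distribution with covariance $t\Sigma$. *)

(* Defs.v *)
From HB Require Import structures.
From mathcomp Require Import all_boot all_order all_algebra.
From mathcomp Require Import all_classical all_reals all_analysis.
Set Implicit Arguments. Unset Strict Implicit. Unset Printing Implicit Defensive.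
Import Order.TTheory GRing.Theory Num.Theory.
Import numFieldNormedType.Exports.
Local Open Scope ring_scope.
Local Open Scope classical_set_scope.

Section Defs.
Variable R : realType.

Fixpoint intRn (n : nat) : ('rV[R]_n -> R) -> R :=
  match n return ('rV[R]_n -> R) -> R with
  | 0 => fun g => g 0
  | n'.+1 => fun g =>
      Rintegral (@lebesgue_measure R) setT
        (fun x : R => intRn (fun v : 'rV[R]_n' => g (row_mx (\row_(_ < 1) x) v)))
  end.

Definition laguerre1 (n : nat) : {poly R} :=
  \poly_(i < n.+1) ((-1) ^+ i * ('C(n.+1, n - i))%:R / (i`!)%:R).

Definition chamberD (N : nat) (x : 'rV[R]_N) : Prop :=
  forall i j : 'I_N, j = i.+1 :> nat ->
    if (j == N.-1 :> nat) then `|x ord0 j| <= x ord0 i else x ord0 j <= x ord0 i.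

(* Unnormalized density of X_{t,k} (Bessel process of type D_N, multiplicity k,
   started at 0) with respect to Lebesgue measure on R^N. *)
Definition besselD_weight (N : nat) (k t : R) (y : 'rV[R]_N) : R :=
  (if `[< chamberD y >] then 1 else 0) *
  expR (- ((y *m y^T) ord0 ord0) / (2 * t)) *
  \prod_(i < N) \prod_(j < N | (i < j)%N)
     ((y ord0 i ^+ 2 - y ord0 j ^+ 2) `^ (2 * k)).

Definition besselD_expect (N : nat) (k t : R) (f : 'rV[R]_N -> R) : R :=
  @intRn N (fun y => f y * besselD_weight k t y) / @intRn N (@besselD_weight N k t).

Definition gauss_weight (N : nat) (C : 'M[R]_N) (x : 'rV[R]_N) : R :=
  expR (- ((x *m invmx C *m x^T) ord0 ord0) / 2).

Definition gauss_expect (N : nat) (C : 'M[R]_N) (f : 'rV[R]_N -> R) : R :=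
  @intRn N (fun x => f x * gauss_weight C x) / @intRn N (gauss_weight C).

Definition rvec (N : nat) (z : nat -> R) : 'rV[R]_N :=
  \row_(i < N) (if (i < N.-1)%N then Num.sqrt (2 * z i) else 0).

Definition Smat (N : nat) (r : 'rV[R]_N) : 'M[R]_N :=
  \matrix_(i < N, j < N)
    (if i == j then
       1 + 2 * (\sum_(l < N | l != i) (r ord0 i - r ord0 l) ^- 2)
         + 2 * (\sum_(l < N | l != i) (r ord0 i + r ord0 l) ^- 2)
     else 2 * (r ord0 i + r ord0 j) ^- 2 - 2 * (r ord0 i - r ord0 j) ^- 2).

End Defs.

(* Main.v *)
(** Substitute [y = x + s r] with [s = sqrt (k t)].  The exponent of the density
    becomes [k] times [Phi (y) = - |y|^2 / 2 + 2 sum_(i < j) ln (y_i^2 - y_j^2)],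
    evaluated at [r + x / s].  The differential equation of [L_(N-1)^(1)] at its
    zeros says that [r] is a critical point of [Phi], so after removing a constant
    the density is [exp (- |x|^2 / (2 t))] times the product, over the roots
    [rho = e_i -+ e_j], of the factors [((1 + h)_+)^(2 k) exp (- 2 k h)] with
    [h = rho(x) / (s rho(r))].  Each factor lies in [[0, 1]] because
    [ln (1 + h) <= h], and tends to [exp (- (rho(x) / rho(r))^2 / t)] by a second
    order expansion.  Dominated convergence, with the Gaussian [exp (- |x|^2 / (2 t))]
    as dominating function, gives the limit [exp (- x S x^T / (2 t))]. *)

Require Import Defs.
From HB Require Import structures.
From mathcomp Require Import all_boot all_order all_algebra.
From mathcomp Require Import all_classical all_reals all_analysis.
From mathcomp Require Import measurable_realfun ring lra.
Import Order.TTheory GRing.Theory Num.Theory.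
Import numFieldNormedType.Exports.
Local Open Scope ring_scope.
Local Open Scope classical_set_scope.

Set Implicit Arguments.
Unset Strict Implicit.
Unset Printing Implicit Defensive.

(** * Lebesgue integrals on the line: dominated convergence, translation, positivity *)

Section RealIntegral.
Variable R : realType.
Local Notation mu := (@lebesgue_measure R).
Local Notation RT := [set: measurableTypeR R].

Lemma integrable_le_continuous (f h : R -> R) : continuous f ->
  (forall x, `|f x| <= h x) -> mu.-integrable RT (EFin \o h) ->
  mu.-integrable RT (EFin \o f).
Proof.
move=> cf fh ih; apply: le_integrable ih => //.
  by apply/measurable_EFinP; exact: continuous_measurable_fun.
by move=> x _; rewrite /= lee_fin (le_trans (fh x))// ler_norm.
Qed.

Lemma Rintegral_dominated_cvg (f_ : nat -> R -> R) (f h : R -> R) :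
  (forall n, continuous (f_ n)) ->
  (forall x, f_ n x @[n --> \oo] --> f x) ->
  mu.-integrable RT (EFin \o h) ->
  (forall n x, `|f_ n x| <= h x) ->
  Rintegral mu RT (f_ n) @[n --> \oo] --> Rintegral mu RT f.
Proof.
move=> cf_ f_f ih f_h.
have mf_ n : measurable_fun RT (f_ n) by exact: continuous_measurable_fun.
have mEf_ n : measurable_fun RT (EFin \o f_ n) by exact/measurable_EFinP.
have Ef_f x : RT x -> (EFin \o f_ n) x @[n --> \oo] --> (EFin \o f) x.
  by move=> _; apply: cvg_EFin; [exact: nearW|exact: f_f].
have Ef_h n x : RT x -> (`|(EFin \o f_ n) x| <= (EFin \o h) x)%E.
  by move=> _; rewrite /= lee_fin f_h.
have mf : measurable_fun RT (EFin \o f).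
  apply/measurable_EFinP.
  by apply: (@measurable_fun_cvg _ _ _ _ f_) => // x _; exact: f_f.
have [ifE _] := dominated_convergence measurableT mEf_ mf (aeW _ Ef_f) ih
  (aeW _ (fun x n => @Ef_h n x)).
rewrite {2}/Rintegral -{1}(fineK (integrable_fin_num measurableT ifE)).
exact: fine_cvg.
Qed.

(** Substitution along [x - c], an increasing bijection of derivative 1. The extended-real form asks
    for no integrability, so applied to the absolute value it also shows that translates of
    integrable functions are integrable. *)
Lemma ge0_integral_shift (f : R -> R) (c : R) : continuous f ->
  (forall x, 0 <= f x) ->
  (\int[mu]_x (f (x - c))%:E = \int[mu]_x (f x)%:E)%E.
Proof.
move=> cf f0.
have dF (x : R) : is_derive x 1 (fun x : R => x - c) 1.
  by rewrite -[X in is_derive _ _ _ X]subr0; apply: is_deriveB.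
have F' : (fun x : R => x - c)^`() = cst 1.
  by apply/funext => x; rewrite derive1E (@derive_val _ _ _ _ _ _ _ (dF x)).
rewrite [RHS](@increasing_ge0_integration_by_substitutionT R (fun x => x - c))//.
- by apply: eq_integral => x _; rewrite F' /= mulr1.
- by move=> x y xy; rewrite ltrD2r.
- by rewrite F' => x; exact: cvg_cst.
- by rewrite F'; exact: is_cvg_cst.
- by rewrite F'; exact: is_cvg_cst.
- apply/cvgrNyPle => A; near=> x.
  by rewrite lerBlDr; near: x; apply: nbhs_ninfty_le; rewrite num_real.
- apply/cvgryPge => A; near=> x.
  by rewrite lerBrDr; near: x; apply: nbhs_pinfty_ge; rewrite num_real.
Unshelve. all: end_near. Qed.

Lemma integrable_shift (f : R -> R) (c : R) : continuous f ->
  mu.-integrable RT (EFin \o f) ->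
  mu.-integrable RT (EFin \o (fun x => f (x - c))).
Proof.
move=> cf /integrableP[_ ifE].
have cfc : continuous (fun x => f (x - c)).
  move=> x; apply: continuous_comp; last exact: cf.
  by apply: cvgB; [exact: cvg_id|exact: cvg_cst].
have cnf : continuous (fun x => `|f x|).
  by move=> x; apply: continuous_comp; [exact: cf|exact: norm_continuous].
apply/integrableP; split.
  by apply/measurable_EFinP; exact: continuous_measurable_fun.
by have /= -> := ge0_integral_shift c cnf (fun x => normr_ge0 _).
Qed.

Lemma Rintegral_shift (f : R -> R) (c : R) : continuous f ->
  mu.-integrable RT (EFin \o f) ->
  Rintegral mu RT (fun x => f (x - c)) = Rintegral mu RT f.
Proof.
move=> cf ifE; have ifcE := integrable_shift c cf ifE.
have cnf : continuous (fun x => `|f x|).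
  by move=> x; apply: continuous_comp; [exact: cf|exact: norm_continuous].
have cfD : continuous (fun x => `|f x| + f x).
  by move=> x; apply: cvgD; [exact: cnf|exact: cf].
have D0 x : 0 <= `|f x| + f x by rewrite -lerBlDr sub0r -normrN ler_norm.
(* The signed case follows from the nonnegative one by writing [g] as the difference of the
   nonnegative functions [|g| + g] and [|g|]. *)
have split_pos (g : R -> R) : mu.-integrable RT (EFin \o g) ->
    Rintegral mu RT g =
    Rintegral mu RT (fun x => `|g x| + g x) - Rintegral mu RT (fun x => `|g x|).
  move=> ig; have ng := integrable_norm ig.
  by rewrite (RintegralD measurableT ng ig) addrAC subrr add0r.
rewrite (split_pos _ ifE) (split_pos _ ifcE).
by congr (fine _ - fine _); apply: ge0_integral_shift => // x.
Qed.

Lemma Rintegral_gt0 (f : R -> R) : mu.-integrable RT (EFin \o f) ->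
  (forall x, 0 < f x) -> 0 < Rintegral mu RT f.
Proof.
move=> ifE f0; rewrite lt_neqAle Rintegral_ge0 ?andbT; last first.
  by move=> x _; exact: ltW.
apply/negP => /eqP int0.
have mf := measurable_int _ ifE.
have abs0 : (\int[mu]_x `|(EFin \o f) x|)%E = 0%E.
  under eq_integral => x _ do rewrite /= gtr0_norm//.
  have := integrable_fin_num measurableT ifE.
  by move=> /fineK <-; rewrite -[fine _]int0.
have [+ _] := ae_eq_integral_abs mu measurableT mf.
move=> /(_ abs0) [N [mN N0 /= sub]].
(* The null set [N] contains every point where [f] is nonzero, hence the whole line, and in
   particular an interval of measure 1. *)
have : (mu `[0%R, 1%R]%classic <= 0)%E.
  rewrite -N0; apply: le_measure; rewrite ?inE// => x _.
  by apply: sub => /= /(_ Logic.I) [] fx0; have := f0 x; rewrite fx0 ltxx.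
by rewrite lebesgue_measure_itv/= lte_fin ltr01 oppr0 adde0 lee_fin ler10.
Qed.

End RealIntegral.

(** * Iterated integrals over row vectors of functions under a product bound *)

Section IteratedIntegral.
Variable R : realType.
Local Notation mu := (@lebesgue_measure R).
Local Notation RT := [set: measurableTypeR R].
Implicit Types n : nat.

(** This form of continuity passes to slices coordinate by coordinate, and sequences are what
    dominated convergence accepts. *)
Definition seq_continuous n (g : 'rV[R]_n -> R) :=
  forall (u : nat -> 'rV[R]_n) (v : 'rV[R]_n),
    (forall i, u m ord0 i @[m --> \oo] --> v ord0 i) ->
    g (u m) @[m --> \oo] --> g v.

(** In dimension [n.+1], [intRn g] unfolds to the integral over [x] of [intRn (slice g x)]. *)
Definition slice n (g : 'rV[R]_n.+1 -> R) (x : R) : 'rV[R]_n -> R :=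
  fun v => g (row_mx (\row_(_ < 1) x) v).

Lemma row_cons0 n (x : R) (v : 'rV[R]_n) :
  (row_mx (\row_(_ < 1) x) v : 'rV[R]_n.+1) ord0 ord0 = x.
Proof.
have := row_mxEl (\row_(_ < 1) x) v ord0 ord0; rewrite [X in _ = X]mxE.
by rewrite (_ : lshift n ord0 = ord0 :> 'I_(1 + n))//; exact: val_inj.
Qed.

Lemma row_consS n (x : R) (v : 'rV[R]_n) (i : 'I_n) :
  (row_mx (\row_(_ < 1) x) v : 'rV[R]_n.+1) ord0 (lift ord0 i) = v ord0 i.
Proof.
have := row_mxEr (\row_(_ < 1) x) v ord0 i.
by rewrite (_ : rshift 1 i = lift ord0 i :> 'I_(1 + n))//; exact: val_inj.
Qed.

Lemma seq_continuous_slice n (g : 'rV[R]_n.+1 -> R) x :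
  seq_continuous g -> seq_continuous (slice g x).
Proof.
move=> cg u v uv; apply: cg => i; case: (unliftP ord0 i) => [j|] ->.
  by rewrite row_consS; under eq_fun do rewrite row_consS; exact: uv.
by rewrite row_cons0; under eq_fun do rewrite row_cons0; exact: cvg_cst.
Qed.

Lemma cvg_slice n (g : 'rV[R]_n.+1 -> R) (y : nat -> R) x v :
  seq_continuous g -> y m @[m --> \oo] --> x ->
  slice g (y m) v @[m --> \oo] --> slice g x v.
Proof.
move=> cg yx; apply: cg => i; case: (unliftP ord0 i) => [j|] ->.
  by rewrite row_consS; under eq_fun do rewrite row_consS; exact: cvg_cst.
by rewrite row_cons0; under eq_fun do rewrite row_cons0.
Qed.

Lemma slice_subr n (g : 'rV[R]_n.+1 -> R) (c : 'rV[R]_n.+1) x :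
  slice (fun v => g (v - c)) x =
  fun v => slice g (x - c ord0 ord0) (v - \row_i c ord0 (lift ord0 i)).
Proof.
apply/funext => v; congr g; apply/rowP => i; rewrite !mxE.
case: (unliftP ord0 i) => [j|] ->.
  by have := row_consS x v j; rewrite mxE => ->;
     have := row_consS (x - c ord0 ord0) (v - \row_i c ord0 (lift ord0 i)) j;
     rewrite !mxE => ->.
by have := row_cons0 x v; rewrite mxE => ->;
   have := row_cons0 (x - c ord0 ord0) (v - \row_i c ord0 (lift ord0 i));
   rewrite !mxE => ->.
Qed.

Variable h : R -> R.
Hypothesis h01 : forall x, 0 <= h x <= 1.
Hypothesis ih : mu.-integrable RT (EFin \o h).

(** A product bound is inherited by slices, with [C] replaced by [C * h x], which is what inductions
    on the dimension require. Later [h] is a one-dimensional Gaussian. *)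
Definition dominated n (C : R) (g : 'rV[R]_n -> R) :=
  forall v, `|g v| <= C * \prod_i h (v ord0 i).

Lemma dominated_slice n C (g : 'rV[R]_n.+1 -> R) x :
  dominated C g -> dominated (C * h x) (slice g x).
Proof.
move=> dg v; apply: (le_trans (dg _)).
rewrite big_ord_recl row_cons0 mulrA.
by rewrite (eq_bigr (fun i => h (v ord0 i)))// => i _; rewrite row_consS.
Qed.

Let I := Rintegral mu RT h.

Lemma integrable_scale (c : R) : mu.-integrable RT (EFin \o (fun x => c * h x)).
Proof.
rewrite (_ : EFin \o _ = (fun x => c%:E * (EFin \o h) x)%E) //.
exact: integrableZl.
Qed.

Definition dominated_intRn_cvg n := forall C (g_ : nat -> 'rV[R]_n -> R) g,
  (forall m, seq_continuous (g_ m)) -> (forall m, dominated C (g_ m)) ->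
  (forall v, g_ m v @[m --> \oo] --> g v) ->
  intRn (g_ m) @[m --> \oo] --> intRn g.

(** Continuity in the outer variable is dominated convergence in the inner ones. Convergence in
    dimension [n] is a premise so that the lemma can serve inside the induction establishing it. *)
Lemma cvg_continuous_intRn_slice n C (g : 'rV[R]_n.+1 -> R) :
  dominated_intRn_cvg n -> seq_continuous g -> dominated C g ->
  continuous (fun x => intRn (slice g x)).
Proof.
move=> IHc cg dg x; apply/(@cvg_nbhsP _ R^o) => y yx.
(* The bound must be uniform in [m]: since [h] is at most 1, [C * h (y m)] is at most the absolute
   value of [C]. *)
apply: (IHc `|C|) => [m|m v|v].
- exact: seq_continuous_slice.
- apply: (le_trans (dominated_slice _ dg v)); apply: ler_wpM2r.
    by apply: prodr_ge0 => i _; case/andP: (h01 (v ord0 i)).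
  have /andP[hy0 hy1] := h01 (y m).
  by rewrite (le_trans (ler_wpM2r hy0 (ler_norm C)))// ler_piMr.
- exact: cvg_slice.
Qed.

(* The bound is what dominates the outer integrand in the next dimension, and
   convergence gives continuity of that integrand, hence its measurability. *)
Lemma intRn_bound_cvg n :
  (forall C (g : 'rV[R]_n -> R), seq_continuous g -> dominated C g ->
     `|intRn g| <= C * I ^+ n) /\
  dominated_intRn_cvg n.
Proof.
elim: n => [|n [IHb IHc]].
  split=> [C g cg dg|C g_ g _ _ gg]; last exact: gg.
  by have := dg 0; rewrite big_ord0 expr0.
have csl C (g : 'rV[R]_n.+1 -> R) := @cvg_continuous_intRn_slice n C g IHc.
have bsl (g : 'rV[R]_n.+1 -> R) C : seq_continuous g -> dominated C g ->
    forall x, `|intRn (slice g x)| <= (C * I ^+ n) * h x.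
  move=> cg dg x; rewrite mulrAC; apply: IHb.
    exact: seq_continuous_slice.
  exact: dominated_slice.
split=> [C g cg dg|C g_ g cg dg gg].
  have ig : mu.-integrable RT (EFin \o (fun x => intRn (slice g x))).
    apply: integrable_le_continuous (csl _ _ cg dg) (bsl _ _ cg dg) _.
    exact: integrable_scale.
  apply: (le_trans (le_normr_Rintegral measurableT ig)).
  rewrite exprSr mulrA -(RintegralZl _ measurableT ih).
  apply: le_Rintegral => //; first exact: integrable_norm.
    exact: integrable_scale.
  by move=> x _; exact: bsl.
apply: (@Rintegral_dominated_cvg _ (fun m x => intRn (slice (g_ m) x)) _
  (fun x => C * I ^+ n * h x)).
- by move=> m; exact: csl.
- move=> x; apply: (IHc (C * h x)) => [m|m|v].
  + exact: seq_continuous_slice.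
  + exact: dominated_slice.
  + exact: gg.
- exact: integrable_scale.
- by move=> m; exact: bsl.
Qed.

Lemma intRn_cvg n : dominated_intRn_cvg n.
Proof. exact: (intRn_bound_cvg n).2. Qed.

Lemma continuous_intRn_slice n C (g : 'rV[R]_n.+1 -> R) :
  seq_continuous g -> dominated C g -> continuous (fun x => intRn (slice g x)).
Proof. exact/cvg_continuous_intRn_slice/intRn_cvg. Qed.

Lemma integrable_intRn_slice n C (g : 'rV[R]_n.+1 -> R) :
  seq_continuous g -> dominated C g ->
  mu.-integrable RT (EFin \o (fun x => intRn (slice g x))).
Proof.
move=> cg dg; apply: integrable_le_continuous (integrable_scale (C * I ^+ n)).
  exact: continuous_intRn_slice cg dg.
move=> x; rewrite mulrAC; apply: (intRn_bound_cvg n).1.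
  exact: seq_continuous_slice.
exact: dominated_slice.
Qed.

Lemma intRnZ n C (c : R) (g : 'rV[R]_n -> R) :
  seq_continuous g -> dominated C g ->
  intRn (fun v => c * g v) = c * intRn g.
Proof.
elim: n C g => [//|n IH] C g cg dg /=.
rewrite -RintegralZl //; last exact: integrable_intRn_slice cg dg.
apply: eq_Rintegral => x _; apply: (IH (C * h x)).
  exact: seq_continuous_slice.
exact: dominated_slice.
Qed.

Lemma intRn_gt0 n C (g : 'rV[R]_n -> R) :
  seq_continuous g -> dominated C g -> (forall v, 0 < g v) -> 0 < intRn g.
Proof.
elim: n C g => [C g _ _ g0|n IH C g cg dg g0]; first exact: g0.
apply: Rintegral_gt0; first exact: integrable_intRn_slice cg dg.
move=> x; apply: (IH (C * h x)) => [||v]; last exact: g0.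
  exact: seq_continuous_slice.
exact: dominated_slice.
Qed.

(** The first coordinate is handled by translation invariance on the line and the others by
    induction; [slice_subr] separates the two shifts. *)
Lemma intRn_subr n C (g : 'rV[R]_n -> R) (c : 'rV[R]_n) :
  seq_continuous g -> dominated C g ->
  intRn (fun v => g (v - c)) = intRn g.
Proof.
elim: n C g c => [|n IH] C g c cg dg; first by rewrite /= [0 - c]thinmx0.
have -> : intRn (fun v => g (v - c)) =
    Rintegral mu RT (fun x => intRn (slice g (x - c ord0 ord0))).
  apply: eq_Rintegral => x _.
  rewrite -[fun v => g (_ - c)]/(slice (fun v => g (v - c)) x) slice_subr.
  apply: (IH (C * h (x - c ord0 ord0))).
    exact: seq_continuous_slice.
  exact: dominated_slice.
have cF := continuous_intRn_slice cg dg.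
have iF := integrable_intRn_slice cg dg.
by rewrite (Rintegral_shift _ cF iF).
Qed.

End IteratedIntegral.

(** * Powers of the positive part and their second order asymptotics *)

Section TruncatedPower.
Variable R : realType.
Implicit Types (p a h k t x : R).

(** The power of the positive part of [a]. Unlike [powR] it vanishes at negative arguments, so it
    can carry the indicator of the chamber, and it is continuous for [p > 0]. *)
Definition pospow p a : R := if 0 < a then expR (p * ln a) else 0.

Lemma pospow_ge0 p a : 0 <= pospow p a.
Proof. by rewrite /pospow; case: ifP => // _; exact: expR_ge0. Qed.

Lemma pospowM p a b : 0 < b -> pospow p (b * a) = pospow p b * pospow p a.
Proof.
move=> b0; rewrite /pospow b0 pmulr_rgt0//; case: ifPn => a0; last by rewrite mulr0.
by rewrite lnM// mulrDr expRD.
Qed.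

Lemma continuous_pospow p : 0 < p -> continuous (pospow p).
Proof.
move=> p0 a; have [a0|a0|->] := ltgtP a 0.
- have pa : pospow p a = 0 by rewrite /pospow ltNge (ltW a0).
  have : \forall x \near a, 0 = pospow p x.
    near=> x; rewrite /pospow ifF//; apply/negbTE; rewrite -leNgt ltW//.
    by near: x; exact: lt_nbhsl.
  by move=> /near_eq_cvg/cvg_trans; rewrite /continuous_at pa; apply; exact: cvg_cst.
- have pa : pospow p a = expR (p * ln a) by rewrite /pospow a0.
  have : \forall x \near a, expR (p * ln x) = pospow p x.
    near=> x; rewrite /pospow ifT//.
    by near: x; exact: lt_nbhsr.
  move=> /near_eq_cvg/cvg_trans; rewrite /continuous_at pa; apply.
  apply: (@continuous_comp _ _ _ (fun x => p * ln x)); last exact: continuous_expR.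
  by apply: cvgM; [exact: cvg_cst|exact: continuous_ln].
- have p00 : pospow p 0 = 0 by rewrite /pospow ltxx.
  rewrite /continuous_at p00; apply/cvgr0Pnorm_lt => e e0; near=> x.
  rewrite ger0_norm ?pospow_ge0// /pospow; case: ifPn => // x0.
  (* For positive [x], the inequality [x ^ p < e] amounts to [x < exp (ln e / p)], a neighbourhood
     of 0. *)
  rewrite -[X in _ < X](lnK e0) ltr_expR mulrC -ltr_pdivlMr//.
  rewrite -ltr_expR lnK ?posrE//; near: x; apply: lt_nbhsl.
  exact: expR_gt0.
Unshelve. all: end_near. Qed.

Definition dampedpow k h : R := pospow (2 * k) (1 + h) * expR (- (2 * k * h)).

Lemma dampedpow_ge0 k h : 0 <= dampedpow k h.
Proof. by rewrite mulr_ge0 ?pospow_ge0 ?expR_ge0. Qed.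

Lemma dampedpow_gt0E k h : 0 < 1 + h ->
  dampedpow k h = expR (2 * k * (ln (1 + h) - h)).
Proof. by move=> h1; rewrite /dampedpow /pospow h1 mulrBr expRD. Qed.

Lemma dampedpow_le1 k h : 0 <= k -> dampedpow k h <= 1.
Proof.
move=> k0; have [h1|h1] := ltP 0 (1 + h); last first.
  by rewrite /dampedpow /pospow ltNge h1 mul0r ler01.
rewrite dampedpow_gt0E// -[leRHS]expR0 ler_expR; apply: mulr_ge0_le0.
  by rewrite mulr_ge0.
by rewrite subr_le0; apply: le_ln1Dx; lra.
Qed.

Lemma continuous_dampedpow k : 0 < k -> continuous (dampedpow k).
Proof.
move=> k0 h; apply: cvgM.
  apply: (@continuous_comp _ _ _ (fun x => 1 + x)); last first.
    by apply: continuous_pospow; rewrite mulr_gt0.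
  by apply: cvgD; [exact: cvg_cst|exact: cvg_id].
apply: (@continuous_comp _ _ _ (fun x => - (2 * k * x)));
  last exact: continuous_expR.
by apply: cvgN; apply: cvgM; [exact: cvg_cst|exact: cvg_id].
Qed.

Lemma ln1Dx_second_order : (ln (1 + x) - x) / x ^+ 2 @[x --> (0 : R)^'] --> (- 2^-1 : R).
Proof.
(* Away from 0 these are the derivatives of numerator and denominator. Their values at 0 are chosen
   so that [df x / dg x = - (2 * (1 + x))^-1] holds in a full neighbourhood of 0. *)
pose df (x : R) := if x == 0 then - 2^-1 else (1 + x)^-1 - 1.
pose dg (x : R) := if x == 0 then 1 else 2 * x.
apply: (@lhopital R (fun x => ln (1 + x) - x) df (fun x => x ^+ 2) dg (-2^-1) 2^-1).
- by rewrite in_itv/=; apply/andP; split; lra.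
- move=> x; rewrite inE/= => -[/=]; rewrite in_itv/= => /andP[x1 x2] /eqP x0.
  rewrite /df (negbTE x0); apply: is_deriveB.
  rewrite -[_^-1]mulr1; apply: (@is_derive1_comp _ (@ln R) (fun x => 1 + x)).
    by apply: is_derive1_ln; lra.
  by rewrite -[X in is_derive _ _ _ X]add0r; apply: is_deriveD.
- move=> x; rewrite inE/= => -[/= _] /eqP x0; rewrite /dg (negbTE x0).
  by apply: is_derive_eq; rewrite (_ : x%:A = x) ?mulr_natl ?mulr2n//; exact: mulr1.
- rewrite [X in _ --> X](_ : 0 = ln (1 + 0) - 0); last by rewrite addr0 ln1 subr0.
  apply: cvgB; last exact: cvg_id.
  apply: (@continuous_comp _ _ _ (fun x => 1 + x) (@ln R) 0).
    by apply: cvgD; [exact: cvg_cst|exact: cvg_id].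
  by apply: continuous_ln; rewrite addr0.
- rewrite [X in _ --> X](_ : 0 = 0 ^+ 2); last by rewrite expr0n.
  exact: exprn_continuous.
- by move=> x; rewrite inE/= => -[/= _] /eqP x0; rewrite /dg (negbTE x0) mulf_neq0.
- have : \forall x \near (0 : R), - (2 * (1 + x))^-1 = df x / dg x.
    near=> x; have x1 : -1 < x by near: x; apply: lt_nbhsr; lra.
    rewrite /df /dg; case: eqP => [->|/eqP x0]; first by rewrite addr0 divr1 mulr1.
    by field; rewrite x0/=; lra.
  move=> /near_eq_cvg/cvg_trans; apply.
  rewrite (_ : - 2^-1 = - (2 * (1 + 0))^-1 :> R); last by rewrite addr0 mulr1.
  apply: cvgN; apply: cvgV; first by rewrite addr0 mulr1 pnatr_eq0.
  by apply: cvgM; [exact: cvg_cst|apply: cvgD; [exact: cvg_cst|exact: cvg_id]].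
Unshelve. all: end_near. Qed.

(** With [h = c / sqrt (u t)] one has [u * h ^ 2 = c ^ 2 / t], so the exponent
    [2 u (ln (1 + h) - h)] is [2 c ^ 2 / t] times a quotient tending to [- 1 / 2]. *)
Lemma cvg_dampedpow (u : nat -> R) t c : 0 < t -> u m @[m --> \oo] --> +oo ->
  dampedpow (u m) (c / Num.sqrt (u m * t)) @[m --> \oo] --> expR (- (c ^+ 2 / t)).
Proof.
(* The second order limit is taken in a punctured neighbourhood, so [h = 0] is treated apart. *)
move=> t0 uy; have [->|c0] := eqVneq c 0.
  rewrite expr0n mul0r oppr0 expR0; under eq_fun do rewrite mul0r.
  rewrite (_ : (fun _ => _) = cst 1); first exact: cvg_cst.
  by apply/funext => m; rewrite /= dampedpow_gt0E addr0// ln1 subr0 mulr0 expR0.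
pose h m := c / Num.sqrt (u m * t).
have u0 : \forall m \near \oo, 0 < u m by exact: cvgry_gt.
have h0 : h m @[m --> \oo] --> (0 : R).
  rewrite -[X in _ --> X](mulr0 c); apply: cvgM; first exact: cvg_cst.
  apply/cvgr0Pnorm_lt => e e0; near=> m.
  have um : (e ^+ 2 * t)^-1 < u m by near: m; exact: cvgry_gt.
  have ut : 0 < u m by apply: lt_trans um; rewrite invr_gt0 mulr_gt0// exprn_gt0.
  rewrite ger0_norm ?invr_ge0 ?sqrtr_ge0//.
  rewrite invf_plt ?posrE ?sqrtr_gt0 ?mulr_gt0//.
  rewrite -[ltLHS]gtr0_norm ?invr_gt0// -sqrtr_sqr ltr_sqrt ?mulr_gt0//.
  by rewrite -ltr_pdivrMr// exprVn -invfM.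
have hN0 : \forall m \near \oo, h m != 0.
  near=> m; rewrite mulf_neq0// invr_neq0// gt_eqF// sqrtr_gt0 mulr_gt0//.
  by near: m.
have hq : (ln (1 + h m) - h m) / h m ^+ 2 @[m --> \oo] --> (- 2^-1 : R).
  apply: (cvg_comp h _ _ ln1Dx_second_order) => A [e /= e0 eA]; near=> m.
  apply: eA; last by near: m.
  by rewrite /= sub0r normrN; near: m; exact: cvgr0_norm_lt.
have : \forall m \near \oo,
    expR (2 * (c ^+ 2 / t) * ((ln (1 + h m) - h m) / h m ^+ 2)) =
    dampedpow (u m) (h m).
  near=> m; rewrite dampedpow_gt0E; last first.
    by rewrite -(subrr 1) ltrD2l; near: m; apply: (cvgr_gt _ h0); rewrite oppr_lt0.
  have um : 0 < u m by near: m.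
  have -> : h m ^+ 2 = c ^+ 2 / (u m * t).
    by rewrite exprMn exprVn sqr_sqrtr// mulr_ge0 ?ltW.
  by congr expR; field; rewrite c0 !gt_eqF.
move=> /near_eq_cvg/cvg_trans; apply.
rewrite (_ : - (c ^+ 2 / t) = 2 * (c ^+ 2 / t) * - 2^-1); last by field; rewrite gt_eqF.
apply: continuous_cvg; first exact: continuous_expR.
by apply: cvgM; [exact: cvg_cst|exact: hq].
Unshelve. all: end_near. Qed.

End TruncatedPower.

(** * The Laguerre differential equation and the relation between its zeros *)

Section LaguerreZeros.
Variable R : realType.
Implicit Types n i : nat.

(** With the binomial in this form the formula covers all [i]: beyond the degree the binomial is
    zero. *)
Lemma coef_laguerre1 n i :
  (laguerre1 R n)`_i = (-1) ^+ i * ('C(n.+1, i.+1))%:R / (i`!)%:R.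
Proof.
rewrite coef_poly ltnS; case: leqP => [le_in|lt_ni].
  by rewrite -(subSS i n) bin_sub.
by rewrite bin_small// mulr0 mul0r.
Qed.

Lemma laguerre1_coef_rec n i :
  (i.+1 * i.+2)%:R * (laguerre1 R n)`_i.+1 = (i%:R - n%:R) * (laguerre1 R n)`_i.
Proof.
rewrite !coef_laguerre1.
(* The term in [i] stands on the left to avoid the truncated subtraction [n - i]. *)
have binE : (i.+2 * 'C(n.+1, i.+2) + i * 'C(n.+1, i.+1) = n * 'C(n.+1, i.+1))%N.
  have [lt_in|le_ni] := ltnP i n.
    have := mul_bin_left n.+1 i.+1; rewrite subSS => ->.
    by rewrite -mulnDl subnK// ltnW.
  have [->|lt_ni] := eqVneq i n; first by rewrite bin_small// muln0.
  by rewrite !bin_small ?muln0//; rewrite ltnS ltn_neqAle eq_sym lt_ni// leqW.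
have binR : i.+2%:R * ('C(n.+1, i.+2))%:R = (n%:R - i%:R) * ('C(n.+1, i.+1))%:R :> R.
  by apply/eqP; rewrite mulrBl eq_sym subr_eq -!natrM -natrD binE.
have fi0 : (i`!)%:R != 0 :> R by rewrite pnatr_eq0 -lt0n fact_gt0.
have i0 : i.+1%:R != 0 :> R by rewrite pnatr_eq0.
rewrite exprS factS !natrM.
transitivity (- ((-1) ^+ i * (i.+2%:R * ('C(n.+1, i.+2))%:R) / (i`!)%:R) : R).
  by field; rewrite nat1r fi0 i0.
by rewrite binR; field.
Qed.

(** In degree [i] the left side has coefficient [(i + 1) (i + 2) a_(i+1) + (n - i) a_i], which
    [laguerre1_coef_rec] makes zero. *)
Lemma laguerre1_ode n : let L := laguerre1 R n in
  'X * L^`()^`() + (2%:P - 'X) * L^`() + n%:R *: L = 0.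
Proof.
move=> L; apply/polyP => i.
rewrite mulrBl !coefD coefN coefZ coefCM coef0 !coefXM.
have rec := laguerre1_coef_rec n i; rewrite -/L in rec.
rewrite !coef_deriv; case: i rec => [|i] rec /=.
  move: rec; rewrite !mulr1n => rec; rewrite add0r subr0 mul1n in rec *.
  by rewrite rec; ring.
rewrite -mulr_natl -[L`_i.+1 *+ _]mulr_natl -mulr_natl.
rewrite (_ : _ + _ = (i.+2 * i.+3)%:R * L`_i.+2 + (n%:R - i.+1%:R) * L`_i.+1).
  by rewrite rec; ring.
by rewrite natrM -[L`_i.+2 *+ _]mulr_natl; ring.
Qed.

Lemma horner_deriv_prod_XsubC (I : Type) (s : seq I) (P : pred I) (w : I -> R) a :
  (forall j, P j -> a != w j) ->
  (\prod_(j <- s | P j) ('X - (w j)%:P))^`().[a] =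
  (\prod_(j <- s | P j) ('X - (w j)%:P)).[a] * \sum_(j <- s | P j) (a - w j)^-1.
Proof.
move=> aw; elim: s => [|j s IH]; first by rewrite !big_nil -polyC1 derivC horner0 mulr0.
rewrite !big_cons; case: ifP => // Pj.
rewrite derivM derivXsubC mul1r !hornerE IH.
by field; rewrite subr_eq0 aw.
Qed.

(** Write [L = c (X - w_i) Q]. Then [L' (w_i) = c Q (w_i)] and [L'' (w_i) = 2 c Q' (w_i)], while
    [Q' / Q] at [w_i] is the sum of the [1 / (w_i - w_j)]. Dividing the differential equation at
    [w_i] by [c Q (w_i)] and by [w_i] gives the relation. *)
Lemma laguerre1_zeros_stationary n (w : 'I_n -> R) (i : 'I_n) : injective w ->
  (forall j, root (laguerre1 R n) (w j)) -> w i != 0 ->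
  2 * \sum_(j | j != i) (w i - w j)^-1 + 2 / w i = 1.
Proof.
move=> inj rw wi0; set L := laguerre1 R n.
have lead : L`_n != 0.
  by rewrite coef_laguerre1 binn mulr1 mulf_neq0 ?invr_neq0 ?signr_eq0// pnatr_eq0
       -lt0n fact_gt0.
have sizeL : size L = n.+1.
  by apply/eqP; rewrite eqn_leq size_poly ltnNge; apply: contra lead =>
     /leq_sizeP -> .
(* The [n] distinct roots exhaust the degree, so [L] splits over them. *)
have LE : L = lead_coef L *: \prod_j ('X - (w j)%:P).
  rewrite {1}(@all_roots_prod_XsubC _ L [seq w j | j <- enum 'I_n]).
  - by rewrite big_map big_enum.
  - by rewrite size_map size_enum_ord.
  - by apply/allP => _ /mapP[j _ ->].
  - by rewrite uniq_rootsE map_inj_uniq// enum_uniq.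
have lc0 : lead_coef L != 0 by rewrite lead_coefE sizeL.
have := congr1 (horner^~ (w i)) (laguerre1_ode n); rewrite -/L /= LE.
set Q := \prod_(j | j != i) ('X - (w j)%:P).
rewrite (bigD1 i)//= -/Q !derivZ !derivM derivXsubC mul1r !derivD derivM derivXsubC mul1r.
rewrite !hornerE subrr !mul0r !addr0.
have dQ : Q^`().[w i] = Q.[w i] * \sum_(j | j != i) (w i - w j)^-1.
  by apply: horner_deriv_prod_XsubC => j ji; apply: contra_neq ji => /inj.
have Q0 : Q.[w i] != 0.
  rewrite horner_prod; apply/prodf_neq0 => j ji.
  by rewrite hornerXsubC subr_eq0; apply: contra_neq ji => /inj.
rewrite dQ; set S := \sum_(j | j != i) _ => eqn.
have {}eqn : (lead_coef L * Q.[w i]) * (w i * (2 * S) + (2 - w i)) = 0.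
  by rewrite -[RHS]eqn /=; ring.
move/eqP: eqn; rewrite !mulf_eq0 (negbTE lc0) (negbTE Q0)/= => /eqP eqn.
apply: (mulfI wi0); rewrite mulr1; apply/eqP; rewrite -subr_eq0 -[X in _ == X]eqn.
by apply/eqP; field.
Qed.

End LaguerreZeros.

(** * The critical point [r] and the quadratic form of [Smat r] *)

Section StationaryPoint.
Variable R : realType.

Lemma sum_offdiag_pairs N (G : 'I_N -> 'I_N -> R) :
  \sum_i \sum_(j | j != i) G i j =
  \sum_(i < N) \sum_(j < N | (i < j)%N) (G i j + G j i).
Proof.
under [RHS]eq_bigr do rewrite big_split/=.
rewrite big_split/= [X in _ + X](exchange_big_dep predT)//= -big_split/=.
apply: eq_bigr => i _; rewrite (bigID (fun j : 'I_N => (i < j)%N))/=.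
congr (_ + _); apply: eq_bigl => j.
  by rewrite andbC andb_idr// => ij; rewrite -val_eqE/= gtn_eqF.
by rewrite -leqNgt -val_eqE/= ltn_neqAle.
Qed.

(** Vanishing of the gradient of [Phi] at [r]. *)
Definition stationary N (r : 'rV[R]_N) := forall i,
  2 * \sum_(j | j != i)
    ((r ord0 i - r ord0 j)^-1 + (r ord0 i + r ord0 j)^-1) = r ord0 i.

(** The open Weyl chamber: every positive root [e_i -+ e_j] is positive at [r]. *)
Definition interiorD N (r : 'rV[R]_N) := forall i j : 'I_N, (i < j)%N ->
  0 < r ord0 i - r ord0 j /\ 0 < r ord0 i + r ord0 j.

Lemma interiorD_neq N (r : 'rV[R]_N) (i j : 'I_N) : interiorD r -> i != j ->
  r ord0 i - r ord0 j != 0 /\ r ord0 i + r ord0 j != 0.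
Proof.
move=> ir; rewrite -val_eqE/= neq_ltn => /orP[] /ir[h1 h2].
  by split; rewrite gt_eqF.
by split; [rewrite -opprB oppr_eq0 gt_eqF|rewrite addrC gt_eqF].
Qed.

(** The gradient equation paired with [x], regrouped over the roots: it evaluates the sum of the
    first order terms [rho(x) / rho(r)]. *)
Lemma stationary_pairs N (r x : 'rV[R]_N) : stationary r ->
  \sum_(i < N) \sum_(j < N | (i < j)%N)
    ((x ord0 i - x ord0 j) / (r ord0 i - r ord0 j) +
     (x ord0 i + x ord0 j) / (r ord0 i + r ord0 j))
  = (\sum_i r ord0 i * x ord0 i) / 2.
Proof.
move=> sr.
transitivity (\sum_i \sum_(j | j != i) x ord0 i *
   ((r ord0 i - r ord0 j)^-1 + (r ord0 i + r ord0 j)^-1)).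
  rewrite sum_offdiag_pairs; apply: eq_bigr => i _; apply: eq_bigr => j _.
  by rewrite -(opprB (r ord0 i)) invrN [r ord0 j + _]addrC; ring.
rewrite mulr_suml; apply: eq_bigr => i _; rewrite -mulr_sumr -{3}(sr i).
by field.
Qed.

(** This sum of squares over the roots yields the invertibility of [Smat r], the Gaussian bound on
    the limit density, and the identification of the limit exponent. *)
Lemma Smat_quadratic N (r x : 'rV[R]_N) :
  (x *m Smat r *m x^T) ord0 ord0 = \sum_i x ord0 i ^+ 2 +
  2 * \sum_(i < N) \sum_(j < N | (i < j)%N)
    (((x ord0 i - x ord0 j) / (r ord0 i - r ord0 j)) ^+ 2 +
     ((x ord0 i + x ord0 j) / (r ord0 i + r ord0 j)) ^+ 2).
Proof.
pose a i j := (r ord0 i - r ord0 j) ^- 2.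
pose b i j := (r ord0 i + r ord0 j) ^- 2.
transitivity (\sum_i x ord0 i ^+ 2 + \sum_i \sum_(j | j != i)
   (2 * x ord0 i ^+ 2 * (a i j + b i j) + 2 * (x ord0 i * x ord0 j) * (b i j - a i j))).
  rewrite -mulmxA mxE -big_split/=; apply: eq_bigr => i _.
  rewrite mxE (bigD1 i)//= !mxE eqxx big_split/=.
  rewrite -mulr_sumr big_split/= -/(a _ _) mulrDr.
  have -> : \sum_(j | j != i) Smat r i j * x^T j ord0 =
      \sum_(j | j != i) 2 * x ord0 j * (b i j - a i j).
    apply: eq_bigr => j ji; rewrite !mxE eq_sym (negbTE ji) -/(a i j) -/(b i j).
    by ring.
  rewrite mulr_sumr /a /b addrA; congr (_ + _); first by ring.
  by apply: eq_bigr => j _; ring.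
rewrite sum_offdiag_pairs mulr_sumr; congr (_ + _).
apply: eq_bigr => i _; rewrite mulr_sumr; apply: eq_bigr => j _.
have -> : a j i = a i j by rewrite /a -(opprB (r ord0 i)) sqrrN.
have -> : b j i = b i j by rewrite /b addrC.
by rewrite !exprMn !exprVn -/(a i j) -/(b i j); ring.
Qed.

Lemma Smat_unit N (r : 'rV[R]_N) : Smat r \in unitmx.
Proof.
rewrite -row_free_unit; apply: inj_row_free => v vS.
have := Smat_quadratic r v; rewrite vS mul0mx mxE => /esym/eqP.
rewrite paddr_eq0; first last.
- rewrite mulr_ge0//; apply: sumr_ge0 => i _; apply: sumr_ge0 => j _.
  by rewrite addr_ge0 ?sqr_ge0.
- by apply: sumr_ge0 => i _; exact: sqr_ge0.
rewrite psumr_eq0 => [/andP[/allP v0 _]|i _]; last exact: sqr_ge0.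
by apply/rowP => i; have := v0 i (mem_index_enum i); rewrite mxE sqrf_eq0 => /eqP.
Qed.

Section RootVector.
Variables (n : nat) (z : nat -> R).
Hypothesis decr : forall i, (i.+1 < n)%N -> z i.+1 < z i.
Hypothesis zroot : forall i, (i < n)%N -> 0 < z i /\ root (laguerre1 R n) (z i).
Let r := rvec n.+1 z.

Let z_lt i j : (i < j)%N -> (j < n)%N -> z j < z i.
Proof.
elim: j => // j IH; rewrite ltnS leq_eqVlt => /orP[/eqP ->|ij] jn; first exact: decr.
by apply: lt_trans (decr jn) (IH ij (ltnW jn)).
Qed.

Let rvec_lt (i : 'I_n.+1) : (i < n)%N -> r ord0 i = Num.sqrt (2 * z i).
Proof. by move=> lt_in; rewrite mxE lt_in. Qed.

Let rvec_last (i : 'I_n.+1) : (n <= i)%N -> r ord0 i = 0.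
Proof. by move=> le_ni; rewrite mxE ltnNge le_ni. Qed.

Let rvec_gt0 (i : 'I_n.+1) : (i < n)%N -> 0 < r ord0 i.
Proof.
by move=> lt_in; rewrite rvec_lt// sqrtr_gt0 mulr_gt0//; case: (zroot lt_in).
Qed.

Lemma interiorD_rvec : interiorD r.
Proof.
move=> i j ij.
have lt_in : (i < n)%N by rewrite (leq_trans ij)// -ltnS.
have ri := rvec_gt0 lt_in.
have [lt_jn|le_nj] := ltnP j n; last by rewrite (rvec_last le_nj) subr0 addr0.
have rj := rvec_gt0 lt_jn; split; last exact: addr_gt0.
rewrite subr_gt0 !rvec_lt// ltr_sqrt; last by case: (zroot lt_in) => *; rewrite mulr_gt0.
by rewrite ltr_pM2l// z_lt.
Qed.

(** Since [r_i ^ 2 = 2 z_i], an index [j < n] contributes [2 r_i / (r_i ^ 2 - r_j ^ 2) = r_i / (z_i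
    - z_j)], and the zero last coordinate contributes [2 / r_i = r_i / z_i]. The equation is thus
    [r_i] times the relation between the zeros. At the last index the terms cancel in pairs. *)
Lemma stationary_rvec : stationary r.
Proof.
move=> i; have [lt_in|le_ni] := ltnP i n; last first.
  rewrite (rvec_last le_ni) big1 ?mulr0// => j _.
  by rewrite sub0r add0r invrN addNr.
pose w (j : 'I_n) := z j.
have rsq (j : 'I_n.+1) : (j < n)%N -> r ord0 j ^+ 2 = 2 * z j.
  by move=> jn; rewrite rvec_lt// sqr_sqrtr// mulr_ge0// ltW//; case: (zroot jn).
have inj : injective w.
  move=> j l wjl; apply: val_inj => /=.
  have {}wjl : z j = z l := wjl.
  by have [jl|lj|//] := ltngtP j l; [have := z_lt jl (ltn_ord l)|have := z_lt lj (ltn_ord j)];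
    rewrite wjl ltxx.
have zi : 0 < z i by case: (zroot lt_in).
have := @laguerre1_zeros_stationary R n w (Ordinal lt_in) inj
  (fun j => (zroot (ltn_ord j)).2) (lt0r_neq0 zi).
rewrite /w/= => crit.
have ri0 := lt0r_neq0 (rvec_gt0 lt_in).
transitivity (r ord0 i * (2 * \sum_(j < n | j != Ordinal lt_in) (z i - z j)^-1 + 2 / z i));
  last by rewrite crit mulr1.
rewrite big_mkcond big_ord_recr/= [in RHS]big_mkcond/=.
rewrite ifT; last by rewrite -val_eqE/= neq_ltn lt_in orbT.
rewrite (rvec_last (leqnn n : (n <= @ord_max n)%N)) subr0 addr0.
have -> : (r ord0 i)^-1 + (r ord0 i)^-1 = r ord0 i * (z i)^-1.
  have -> : z i = r ord0 i ^+ 2 / 2 by rewrite rsq// mulrC mulrA mulVf// mul1r.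
  by field.
rewrite 2!mulrDr; congr (_ + _); last by ring.
rewrite mulrCA !mulr_sumr; apply: eq_bigr => j _.
rewrite -!val_eqE/=; case: ifPn => ji; last by rewrite !mulr0.
set j' := widen_ord _ j.
have j'i : i != j' by rewrite -val_eqE/= eq_sym.
have [d1 d2] := interiorD_neq interiorD_rvec j'i.
have -> : (z i - z j)^-1 = 2 / ((r ord0 i - r ord0 j') * (r ord0 i + r ord0 j')).
  have -> : z i - z j = (r ord0 i ^+ 2 - r ord0 j' ^+ 2) / 2.
    by rewrite !rsq//=; field.
  by rewrite subr_sqr invfM invrK mulrC.
by field; rewrite d1 d2.
Qed.

End RootVector.
End StationaryPoint.

(** * The Bessel density in coordinates centred at [sqrt (k t) r] *)

Section BesselWeight.
Variable R : realType.

Lemma chamberD_le N (y : 'rV[R]_N) (i j : 'I_N) : chamberD y -> (i < j)%N ->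
  `|y ord0 j| <= y ord0 i.
Proof.
case: N y i j => [y []//|n] y i j cy.
pose Y m := y ord0 (inord m).
have YE (l : 'I_n.+1) : y ord0 l = Y l by rewrite /Y inord_val.
have step m : (m < n)%N -> `|Y m.+1| <= Y m.
  (* Descent from the last index: the bound at [m.+1] makes [Y m.+1] nonnegative, which turns the
     plain inequality of the chamber at [m] into one with absolute value. *)
  have [d] := ubnP (n - m); elim: d m => // d IH m lt_d lt_mn.
  have /= := cy (inord m) (inord m.+1); rewrite !inordK ?ltnS ?(ltnW lt_mn)// => /(_ erefl).
  case: eqP => // /eqP mn le_Y.
  have lt_m1n : (m.+1 < n)%N by rewrite ltn_neqAle mn.
  have Y0 : 0 <= Y m.+1.
    apply: le_trans (normr_ge0 (Y m.+2)) (IH m.+1 _ lt_m1n).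
    by rewrite -ltnS (leq_trans _ lt_d)// ltnS ltn_sub2l.
  by rewrite ger0_norm.
rewrite !YE; have := ltn_ord j; move: (val i) (val j) => {}i {}j.
elim: j => // j IH lt_jn; rewrite ltnS leq_eqVlt => /orP[/eqP ->|lt_ij].
  exact: step.
apply: le_trans (step _ lt_jn) (le_trans (ler_norm _) (IH (ltnW lt_jn) lt_ij)).
Qed.

Lemma powR_pospow (p a : R) : 0 < p -> 0 <= a -> a `^ p = pospow p a.
Proof.
move=> p0; rewrite le_eqVlt => /orP[/eqP <-|a0].
  by rewrite powR0 ?gt_eqF// /pospow ltxx.
by rewrite /powR /pospow a0 gt_eqF.
Qed.

Lemma powR_sqrB (k a b : R) : 0 < k -> `|b| <= a ->
  (a ^+ 2 - b ^+ 2) `^ (2 * k) = pospow (2 * k) (a - b) * pospow (2 * k) (a + b).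
Proof.
move=> k0; rewrite ler_norml => /andP[ab1 ab2].
have k20 : 0 < 2 * k by rewrite mulr_gt0.
have amb : 0 <= a - b by rewrite subr_ge0.
have apb : 0 <= a + b by rewrite -lerBlDr sub0r lerNl.
by rewrite subr_sqr powRM// !powR_pospow.
Qed.

(* Off the chamber some factor has a nonpositive argument, so truncating the
   powers makes the indicator function superfluous. *)
Lemma besselD_weightE N (k t : R) (y : 'rV[R]_N) : 0 < k ->
  besselD_weight k t y = expR (- (\sum_i y ord0 i ^+ 2) / (2 * t)) *
  \prod_(i < N) \prod_(j < N | (i < j)%N)
    (pospow (2 * k) (y ord0 i - y ord0 j) * pospow (2 * k) (y ord0 i + y ord0 j)).
Proof.
move=> k0; rewrite /besselD_weight.
have -> : (y *m y^T) ord0 ord0 = \sum_i y ord0 i ^+ 2.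
  by rewrite mxE; apply: eq_bigr => i _; rewrite mxE.
case: asboolP => [cy|ncy].
  rewrite mul1r; congr (_ * _); apply: eq_bigr => i _; apply: eq_bigr => j ij.
  by rewrite powR_sqrB// chamberD_le.
rewrite !mul0r; apply/esym/eqP; rewrite mulf_eq0 gt_eqF ?expR_gt0//=.
move: ncy => /existsNP[i /existsNP[j /not_implyP[ji nle]]].
have ij : (i < j)%N by rewrite ji.
apply/prodf_eq0; exists i => //; apply/prodf_eq0; exists j => //.
rewrite mulf_eq0.
have : ~~ (`|y ord0 j| <= y ord0 i).
  apply/negP => yji; apply: nle; case: ifP => // _.
  exact: le_trans (ler_norm _) yji.
rewrite ler_norml negb_and => /orP[]; rewrite -ltNge => yy; apply/orP.
  by right; rewrite /pospow ifF// ltNge; apply/negbTE/negPn; lra.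
by left; rewrite /pospow ifF// ltNge; apply/negbTE/negPn; lra.
Qed.

Definition rescaled_weight N (k t : R) (r x : 'rV[R]_N) : R :=
  expR (- (\sum_i x ord0 i ^+ 2) / (2 * t)) *
  \prod_(i < N) \prod_(j < N | (i < j)%N)
    (dampedpow k ((x ord0 i - x ord0 j) / (r ord0 i - r ord0 j) / Num.sqrt (k * t)) *
     dampedpow k ((x ord0 i + x ord0 j) / (r ord0 i + r ord0 j) / Num.sqrt (k * t))).

(** Factor out [s * rho], leaving [1 + h] with [h = delta / rho / s]. The last exponential undoes
    the damping; being linear in [delta], it can be collected over all roots by
    [stationary_pairs]. *)
Lemma pospow_dampedpow (k s rho delta : R) : 0 < s -> 0 < rho ->
  pospow (2 * k) (delta + s * rho) =
  pospow (2 * k) (s * rho) * dampedpow k (delta / rho / s) *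
  expR (2 * k / s * (delta / rho)).
Proof.
move=> s0 rho0.
have -> : delta + s * rho = s * rho * (1 + delta / rho / s).
  by field; rewrite !gt_eqF.
rewrite pospowM ?mulr_gt0// /dampedpow -!mulrA; congr (_ * _).
rewrite -expRD [X in expR X](_ : _ = 0) ?expR0 ?mulr1//.
by field; rewrite !gt_eqF.
Qed.

(* Stationarity of [r] cancels the linear terms of the exponent. *)
Lemma besselD_weight_shift N (k t : R) (r : 'rV[R]_N) :
  0 < k -> 0 < t -> interiorD r -> stationary r ->
  exists2 K : R, 0 < K & forall x : 'rV[R]_N,
    besselD_weight k t (x + Num.sqrt (k * t) *: r) = K * rescaled_weight k t r x.
Proof.
move=> k0 t0 ir sr; set s : R := Num.sqrt (k * t).
have s0 : 0 < s by rewrite sqrtr_gt0 mulr_gt0.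
have s2 : s ^+ 2 = k * t by rewrite sqr_sqrtr// mulr_ge0// ltW.
(* The constant is the weight at the base point [s *: r]. *)
exists (expR (- (s ^+ 2 * \sum_i r ord0 i ^+ 2) / (2 * t)) *
  \prod_(i < N) \prod_(j < N | (i < j)%N)
    (pospow (2 * k) (s * (r ord0 i - r ord0 j)) *
     pospow (2 * k) (s * (r ord0 i + r ord0 j)))).
  rewrite mulr_gt0 ?expR_gt0//; apply: prodr_gt0 => i _; apply: prodr_gt0 => j ij.
  by have [h1 h2] := ir _ _ ij; rewrite /pospow !mulr_gt0 ?ifT ?expR_gt0// mulr_gt0.
move=> x; rewrite besselD_weightE//.
pose e (i j : 'I_N) : R := (x ord0 i - x ord0 j) / (r ord0 i - r ord0 j) +
  (x ord0 i + x ord0 j) / (r ord0 i + r ord0 j).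
pose D (i j : 'I_N) :=
  dampedpow k ((x ord0 i - x ord0 j) / (r ord0 i - r ord0 j) / s) *
  dampedpow k ((x ord0 i + x ord0 j) / (r ord0 i + r ord0 j) / s).
pose P (i j : 'I_N) := pospow (2 * k) (s * (r ord0 i - r ord0 j)) *
  pospow (2 * k) (s * (r ord0 i + r ord0 j)).
rewrite [X in _ * X = _](eq_bigr (fun i : 'I_N => (\prod_(j < N | (i < j)%N) P i j) *
    (\prod_(j < N | (i < j)%N) D i j) *
    expR (\sum_(j < N | (i < j)%N) 2 * k / s * e i j))); last first.
  move=> i _; rewrite expR_sum -!big_split/=; apply: eq_bigr => j ij.
  have [h1 h2] := ir _ _ ij; rewrite !mxE.
  have -> : x ord0 i + s * r ord0 i - (x ord0 j + s * r ord0 j) =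
    (x ord0 i - x ord0 j) + s * (r ord0 i - r ord0 j) by ring.
  have -> : x ord0 i + s * r ord0 i + (x ord0 j + s * r ord0 j) =
    (x ord0 i + x ord0 j) + s * (r ord0 i + r ord0 j) by ring.
  by rewrite !pospow_dampedpow// /P /D /e [2 * k / s * (_ + _)]mulrDr expRD; ring.
rewrite !big_split/= -expR_sum.
under [in expR (\sum_(i < N) _)]eq_bigr do rewrite -mulr_sumr.
rewrite -mulr_sumr stationary_pairs// /rescaled_weight -/s -/P.
set A := \prod_(i < N) _; set B := \prod_(i < N) _.
set E1 := expR _; set E2 := expR _; set E3 := expR _; set E4 := expR _.
(* The cross term of the square norm gives [- (s / t) <r, x>], the collected linear terms give
   [(k / s) <r, x>], and [s ^ 2 = k t] makes them cancel. *)
suff : E1 * E2 = E3 * E4.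
  move=> EE. transitivity (A * B * (E1 * E2)); first by ring.
  by rewrite EE; ring.
rewrite -!expRD; congr expR.
have -> : \sum_i (x + s *: r) ord0 i ^+ 2 = \sum_i x ord0 i ^+ 2 +
   2 * s * (\sum_i r ord0 i * x ord0 i) + s ^+ 2 * (\sum_i r ord0 i ^+ 2).
  rewrite !mulr_sumr -!big_split/=; apply: eq_bigr => i _; rewrite !mxE; ring.
have -> : t = s ^+ 2 / k by rewrite s2 mulrAC divff ?mul1r ?gt_eqF.
by field; rewrite !gt_eqF.
Qed.

Lemma rescaled_weight_ge0 N (k t : R) (r x : 'rV[R]_N) :
  0 <= rescaled_weight k t r x.
Proof.
rewrite mulr_ge0 ?expR_ge0//; apply: prodr_ge0 => i _; apply: prodr_ge0 => j _.
by rewrite mulr_ge0 ?dampedpow_ge0.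
Qed.

Lemma rescaled_weight_le N (k t : R) (r x : 'rV[R]_N) : 0 <= k ->
  rescaled_weight k t r x <= \prod_i expR (- (x ord0 i ^+ 2) / (2 * t)).
Proof.
move=> k0; rewrite -expR_sum -mulr_suml sumrN ler_piMr ?expR_ge0//.
apply: prodr_ile1 => i _; apply/andP; split.
  by apply: prodr_ge0 => j _; rewrite mulr_ge0 ?dampedpow_ge0.
apply: prodr_ile1 => j _; apply/andP; split.
  by rewrite mulr_ge0 ?dampedpow_ge0.
by apply: mulr_ile1; rewrite ?dampedpow_ge0 ?dampedpow_le1.
Qed.

End BesselWeight.

(** * Continuity and pointwise convergence of the rescaled density *)

Section Limit.
Variable R : realType.
Local Notation mu := (@lebesgue_measure R).
Local Notation RT := [set: measurableTypeR R].

Lemma cvgr_prod (I : Type) (s : seq I) (P : pred I) (F : I -> nat -> R) (l : I -> R) :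
  (forall i, P i -> F i m @[m --> \oo] --> l i) ->
  \prod_(i <- s | P i) F i m @[m --> \oo] --> \prod_(i <- s | P i) l i.
Proof. by move=> Fl; apply: cvg_big => //; exact: mul_continuous. Qed.

Lemma cvgr_sum (I : Type) (s : seq I) (P : pred I) (F : I -> nat -> R) (l : I -> R) :
  (forall i, P i -> F i m @[m --> \oo] --> l i) ->
  \sum_(i <- s | P i) F i m @[m --> \oo] --> \sum_(i <- s | P i) l i.
Proof. by move=> Fl; apply: cvg_big => //; exact: add_continuous. Qed.

Lemma continuous_seq_continuous N (f : 'rV[R]_N -> R) :
  continuous f -> seq_continuous f.
Proof.
move=> cf u v uv; apply: continuous_cvg; first exact: cf.
apply/cvg_ballP => e e0.
have : \forall m \near \oo, forall i, ball (v ord0 i) e (u m ord0 i).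
  by apply: filter_forall => i; have /cvg_ballP := uv i; exact.
by apply: filterS => m vu; split=> // i j; rewrite (ord1 i).
Qed.

Lemma seq_continuous_rescaled_weight N (k t : R) (r : 'rV[R]_N) : 0 < k ->
  seq_continuous (rescaled_weight k t r).
Proof.
move=> k0 u v uv; apply: cvgM.
  apply: continuous_cvg; first exact: continuous_expR.
  apply: cvgM; last exact: cvg_cst.
  apply: cvgN; apply: cvgr_sum => i _.
  apply: (@continuous_cvg _ _ _ _ _ _ (fun y : R => y ^+ 2)).
    exact: exprn_continuous.
  exact: uv.
apply: cvgr_prod => i _; apply: cvgr_prod => j _; apply: cvgM.
  apply: continuous_cvg; first exact: continuous_dampedpow.
  apply: cvgM; last exact: cvg_cst.
  by apply: cvgM; [exact: cvgB|exact: cvg_cst].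
apply: continuous_cvg; first exact: continuous_dampedpow.
apply: cvgM; last exact: cvg_cst.
by apply: cvgM; [exact: cvgD|exact: cvg_cst].
Qed.

Lemma cvg_rescaled_weight N (u : nat -> R) (t : R) (r x : 'rV[R]_N) : 0 < t ->
  u m @[m --> \oo] --> +oo ->
  rescaled_weight (u m) t r x @[m --> \oo] -->
  expR (- ((x *m Smat r *m x^T) ord0 ord0) / (2 * t)).
Proof.
move=> t0 uy; rewrite Smat_quadratic.
pose a i j : R := (x ord0 i - x ord0 j) / (r ord0 i - r ord0 j).
pose b i j : R := (x ord0 i + x ord0 j) / (r ord0 i + r ord0 j).
rewrite [X in _ --> X](_ : _ = expR (- (\sum_i x ord0 i ^+ 2) / (2 * t)) *
  \prod_(i < N) \prod_(j < N | (i < j)%N)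
    (expR (- (a i j ^+ 2 / t)) * expR (- (b i j ^+ 2 / t)))); last first.
  have -> : \prod_(i < N) \prod_(j < N | (i < j)%N)
      (expR (- (a i j ^+ 2 / t)) * expR (- (b i j ^+ 2 / t))) =
      expR (- (\sum_(i < N) \sum_(j < N | (i < j)%N) (a i j ^+ 2 + b i j ^+ 2)) / t).
    rewrite mulNr mulr_suml -sumrN expR_sum; apply: eq_bigr => i _.
    rewrite mulr_suml -sumrN expR_sum; apply: eq_bigr => j _.
    by rewrite -expRD -opprD -mulrDl.
  by rewrite -expRD; congr expR; field; rewrite gt_eqF.
apply: cvgM; first exact: cvg_cst.
apply: cvgr_prod => i _; apply: cvgr_prod => j _.
by apply: cvgM; exact: cvg_dampedpow.
Qed.

(** Up to the factor [normal_peak] this is the normal density of mean 0 and standard deviation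
    [sqrt t]. *)
Lemma integrable_gaussian (t : R) : 0 < t ->
  mu.-integrable RT (EFin \o (fun x : R => expR (- (x ^+ 2) / (2 * t)))).
Proof.
move=> t0; pose s : R := Num.sqrt t.
have s0 : s != 0 by rewrite gt_eqF// sqrtr_gt0.
have pk : 0 < normal_peak s by exact: normal_peak_gt0.
have := integrableZl measurableT (normal_peak s)^-1 (integrable_normal_pdf 0 s).
rewrite (_ : (fun x => _) = EFin \o (fun x : R => expR (- (x ^+ 2) / (2 * t))))//.
apply/funext => x /=; rewrite -EFinM normal_pdfE// mulKf ?gt_eqF//.
by rewrite /normal_fun subr0 sqr_sqrtr ?ltW// mulr_natl.
Qed.

Lemma gauss_weightE N (t : R) (S : 'M[R]_N) (x : 'rV[R]_N) : 0 < t ->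
  S \in unitmx ->
  gauss_weight (t *: invmx S) x =
  expR (- ((x *m S *m x^T) ord0 ord0) / (2 * t)).
Proof.
move=> t0 uS; rewrite /gauss_weight invmxZ; last first.
  by rewrite unitmxZ ?unitmx_inv// unitfE gt_eqF.
rewrite invmxK -scalemxAr -scalemxAl mxE; congr expR.
by field; rewrite gt_eqF.
Qed.

End Limit.

(** * Convergence of expectations along sequences of multiplicities *)

Section MainLimit.
Variables (R : realType) (n : nat) (t : R) (r : 'rV[R]_n).
Hypotheses (t0 : 0 < t) (ir : interiorD r) (sr : stationary r).

Let h (x : R) := expR (- (x ^+ 2) / (2 * t)).

Let h01 x : 0 <= h x <= 1.
Proof.
rewrite expR_ge0 -[leRHS]expR0 ler_expR mulNr oppr_le0.
by rewrite divr_ge0 ?sqr_ge0// mulr_ge0// ltW.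
Qed.

Let ih := integrable_gaussian t0.

Let g (x : 'rV[R]_n) := expR (- ((x *m Smat r *m x^T) ord0 ord0) / (2 * t)).

(** Needed to pass to the limit in the normalising denominator. Domination by the product of the [h]
    holds because [x S x^T] is at least the square norm of [x]. *)
Lemma intRn_gauss_gt0 : 0 < intRn g.
Proof.
apply: (@intRn_gt0 R h h01 ih n 1) => [u v uv|v|v]; last exact: expR_gt0.
  apply: (@continuous_cvg _ _ _ _ _ _ (@expR R)); first exact: continuous_expR.
  apply: cvgM; last exact: cvg_cst.
  have quadE (x : 'rV[R]_n) : (x *m Smat r *m x^T) ord0 ord0 =
      \sum_i (\sum_j x ord0 j * Smat r j i) * x ord0 i.
    by rewrite mxE; apply: eq_bigr => i _; rewrite [x^T _ _]mxE [X in X * _]mxE.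
  apply: cvgN; rewrite quadE; under eq_fun do rewrite quadE.
  apply: cvgr_sum => i _; apply: cvgM; last exact: uv.
  by apply: cvgr_sum => j _; apply: cvgM; [exact: uv|exact: cvg_cst].
rewrite mul1r ger0_norm ?expR_ge0// -expR_sum ler_expR.
rewrite -mulr_suml sumrN ler_wpM2r ?invr_ge0 ?mulr_ge0 ?(ltW t0)// lerN2.
rewrite Smat_quadratic lerDl mulr_ge0//; apply: sumr_ge0 => i _.
by apply: sumr_ge0 => j _; rewrite addr_ge0 ?sqr_ge0.
Qed.

Variables (f : 'rV[R]_n -> R) (M : R).
Hypotheses (cf : seq_continuous f) (fM : forall x, `|f x| <= M).

Let M0 : 0 <= M := le_trans (normr_ge0 _) (fM 0).

Let seq_continuous_f_weight k : 0 < k ->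
  seq_continuous (fun x => f x * rescaled_weight k t r x).
Proof.
move=> k0 u v uv; apply: cvgM; first exact: cf.
exact: seq_continuous_rescaled_weight.
Qed.

Let dominated_weight k : 0 < k -> dominated h 1 (rescaled_weight k t r).
Proof.
move=> k0 x; rewrite mul1r ger0_norm ?rescaled_weight_ge0//.
exact/rescaled_weight_le/ltW.
Qed.

Let dominated_f_weight k : 0 < k ->
  dominated h M (fun x => f x * rescaled_weight k t r x).
Proof.
move=> k0 x; rewrite normrM ler_pM//.
by have := dominated_weight k0 x; rewrite mul1r.
Qed.

(** Translation invariance moves the centre to 0, and the constant [K] cancels between numerator and
    denominator. *)
Lemma besselD_expect_rescaled k : 0 < k ->
  besselD_expect k t (fun y => f (y - Num.sqrt (k * t) *: r)) =
  intRn (fun x => f x * rescaled_weight k t r x) / intRn (rescaled_weight k t r).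
Proof.
move=> k0; have [K K0 KE] := besselD_weight_shift k0 t0 ir sr.
set s : 'rV[R]_n := Num.sqrt (k * t) *: r.
have wE y : besselD_weight k t y = K * rescaled_weight k t r (y - s).
  by rewrite -KE subrK.
rewrite /besselD_expect (funext wE).
have -> : (fun y => f (y - s) * (K * rescaled_weight k t r (y - s))) =
    (fun y => (fun x => K * (f x * rescaled_weight k t r x)) (y - s)).
  by apply/funext => y /=; rewrite mulrCA.
have KZ C (F : 'rV[R]_n -> R) : seq_continuous F -> dominated h C F ->
    intRn (fun y => K * F (y - s)) = K * intRn F.
  move=> cF dF.
  have cKF : seq_continuous (fun x => K * F x).
    by move=> u v uv; apply: cvgM; [exact: cvg_cst|exact: cF].
  have dKF : dominated h (K * C) (fun x => K * F x).
    move=> x; rewrite normrM (ger0_norm (ltW K0)) -mulrA.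
    by rewrite ler_pM2l.
  by rewrite (@intRn_subr R h h01 ih n (K * C) (fun x => K * F x))// (@intRnZ R h h01 ih n C).
rewrite (KZ M (fun x => f x * rescaled_weight k t r x))//; first last.
- exact: dominated_f_weight.
- exact: seq_continuous_f_weight.
rewrite (KZ 1); first last.
- exact: dominated_weight.
- exact: seq_continuous_rescaled_weight.
by rewrite -mulf_div divff ?gt_eqF// mul1r.
Qed.

Lemma cvg_besselD_expect (u : nat -> R) : (forall m, 0 < u m) ->
  u m @[m --> \oo] --> +oo ->
  besselD_expect (u m) t (fun y => f (y - Num.sqrt (u m * t) *: r))
    @[m --> \oo] --> gauss_expect (t *: invmx (Smat r)) f.
Proof.
move=> u0 uy; under eq_fun do rewrite besselD_expect_rescaled//.
rewrite /gauss_expect.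
have -> : gauss_weight (t *: invmx (Smat r)) = g.
  by apply/funext => x; rewrite gauss_weightE ?Smat_unit.
apply: cvgM.
  apply: (@intRn_cvg R h h01 ih n M) => [m|m|v].
  - exact: seq_continuous_f_weight.
  - exact: dominated_f_weight.
  - by apply: cvgM; [exact: cvg_cst|exact: cvg_rescaled_weight].
apply: cvgV; first by rewrite gt_eqF// intRn_gauss_gt0.
apply: (@intRn_cvg R h h01 ih n 1) => [m|m|v].
- exact: seq_continuous_rescaled_weight.
- exact: dominated_weight.
- exact: cvg_rescaled_weight.
Qed.

End MainLimit.

Theorem theorem5p2 (R : realType) (N : nat) (z : nat -> R) :
  (1 <= N)%N ->
  (forall i, (i.+1 < N.-1)%N -> z i.+1 < z i) ->
  (forall i, (i < N.-1)%N -> 0 < z i /\ root (laguerre1 R N.-1) (z i)) ->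
  let r := rvec N z in
  let S := Smat r in
  S \in unitmx /\
  forall t : R, 0 < t ->
  forall f : 'rV[R]_N -> R, continuous f -> (exists M : R, forall x, `|f x| <= M) ->
    (fun k : R => besselD_expect k t (fun y => f (y - Num.sqrt (k * t) *: r)))
      @ +oo --> gauss_expect (t *: invmx S) f.
Proof.
case: N => // n _ decr zroot r S; split; first exact: Smat_unit.
move=> t t0 f cf [M fM]; apply/cvg_pinftyP => u uy.
(* A sequence tending to infinity may start with nonpositive terms; [v] is positive throughout and
   eventually equal to [u]. *)
pose v m := Num.max 1 (u m).
have uv : \forall m \near \oo, u m = v m.
  by near=> m; apply/esym/max_idPr; near: m; exact: cvgry_ge.
have vy : v m @[m --> \oo] --> +oo.
  exact: cvg_trans (near_eq_cvg uv) uy.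
have v0 m : 0 < v m by rewrite lt_max ltr01.
have cv := cvg_besselD_expect t0 (interiorD_rvec decr zroot)
  (stationary_rvec decr zroot) (continuous_seq_continuous cf) fM v0 vy.
apply: cvg_trans cv; apply: near_eq_cvg; near=> m.
by have -> : u m = v m by near: m.
Unshelve. all: end_near. Qed.
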